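(* Let $G$ be a simply connected simple complex Lie group of classical type with Lie algebra $\mathfrak{g}$ (so $\mathfrak g$ is of type $A$, $B$, $C$ or $D$), let $\mathfrak{h}\subset\mathfrak g$ be a Cartan subalgebra, and let $\mu\in P^{\vee}$ be a coweight. Put $\tau_{\mu}=\exp(\ln(\xi)\,\mu)$ for a choice of branch of the logarithm. Then the map $x\mapsto \tau_{\mu}x\tau_{\mu}^{-1}$ (which does not depend on the branch) defines an automorphism $\varphi_{\mu}$ of the loop algebra $\mathfrak{g}\otimes\mathbb{C}((\xi))$. Furthermore, $\varphi_\mu$ coincides with the automorphism of $\mathfrak{g}\otimes \mathbb{C}((\xi))=\widehat{\mathfrak g}/\mathbb{C}c$ induced by the single-shift automorphism $\sigma_{\mu}$ of $\widehat{\mathfrak g}$.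
   Context: $\Delta$ is the set of roots of $(\mathfrak g,\mathfrak h)$. The coweight lattice is $P^\vee=\{x\in\mathfrak h:\alpha(x)\in\mathbb Z\text{ for all }\alpha\in\Delta\}$. Let $\langle\,,\,\rangle$ be the Cartan–Killing form on $\mathfrak g$ normalized so that $\langle\theta,\theta\rangle=2$ for the longest root $\theta$ (after identifying $\mathfrak h$ with $\mathfrak h^*$ by the form). The affine Lie algebra is $\widehat{\mathfrak g}=\mathfrak g\otimes\mathbb C((\xi))\oplus\mathbb Cc$, with $c$ central and $[X\otimes f,Y\otimes g]=[X,Y]\otimes fg+\langle X,Y\rangle\operatorname{Res}_{\xi=0}(g\,df)\,c$. Write $X(n)=X\otimes\xi^n$. For each $\alpha\in\Delta$ let $X_\alpha$ be a nonzero element of the root space $\mathfrak g_\alpha$, chosen as part of a Chevalley basis. For $\mu\in P^\vee$ the single-shift automorphism $\sigma_\mu$ of $\widehat{\mathfrak g}$ is given by $\sigma_\mu(c)=c$, $\sigma_\mu(h(n))=h(n)+\delta_{n,0}\langle\mu,h\rangle c$ for $h\in\mathfrak h$, $n\in\mathbb Z$, and $\sigma_\mu(X_\alpha(n))=X_\alpha(n+\alpha(\mu))$, extended to Laurent series in the evident way: $h\otimes f\mapsto h\otimes f+\langle\mu,h\rangle\operatorname{Res}_{\xi=0}(\xi^{-1}f\,d\xi)\,c$ and $X_\alpha\otimes f\mapsto X_\alpha\otimes\xi^{\alpha(\mu)}f$. The expression $\tau_\mu x\tau_\mu^{-1}$ is computed with $\mathfrak g$ realized as a classical matrix Lie algebra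 with $\mathfrak h$ diagonal; $\tau_\mu$ is then a diagonal matrix whose entries are (possibly fractional) powers of $\xi$. *)

(* Defs.v *)
From HB Require Import structures.
From mathcomp Require Import all_boot all_order all_algebra.
From mathcomp Require Import complex ring.
From mathcomp Require Import all_classical all_reals all_analysis.

Set Implicit Arguments.
Unset Strict Implicit.
Unset Printing Implicit Defensive.

Import Order.TTheory GRing.Theory Num.Theory.

Local Open Scope classical_set_scope.
Local Open Scope ring_scope.

Section Support.
Variable G : numDomainType.

Definition admissible (A : set G) : Prop :=
  exists s : seq G, forall a, A a -> exists2 b, b \in s & exists n, a = b + n%:R.

Definition sumset (A B : set G) : set G := [set c | exists2 a, A a & B (c - a)].

Lemma admissible_sub (A B : set G) : A `<=` B -> admissible B -> admissible A.
Proof. by move=> AB [s sP]; exists s => a /AB /sP. Qed.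

Lemma admissible1 (a : G) : admissible [set a].
Proof.
exists [:: a] => _ ->; exists a; first by rewrite inE.
by exists 0%N; rewrite addr0.
Qed.

Lemma admissible0 : admissible set0. Proof. by exists [::]. Qed.

Lemma admissibleU (A B : set G) :
  admissible A -> admissible B -> admissible (A `|` B).
Proof.
move=> [s sP] [t tP]; exists (s ++ t) => a [/sP|/tP] [b bs [n ->]];
  by exists b; [rewrite mem_cat bs ?orbT | exists n].
Qed.

Lemma admissible_sumset (A B : set G) :
  admissible A -> admissible B -> admissible (sumset A B).
Proof.
move=> [s sP] [t tP]; exists [seq x + y | x <- s, y <- t] => c [a].
move=> /sP [x xs [m ax]] /tP [y yt [n]].
move=> /(congr1 (+%R^~ a)); rewrite subrK => ->.
exists (x + y); first by apply/allpairsP; exists (x, y).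
by exists (n + m)%N; rewrite ax natrD; ring.
Qed.

Lemma finite_conv (A B : set G) (c : G) : admissible A -> admissible B ->
  finite_set [set a | A a /\ B (c - a)].
Proof.
move=> [s sP] [t tP].
pose S x y := [set m : nat | exists n : nat, c - x - y = (m + n)%:R].
have finS x y : finite_set (S x y).
  have [[m0 [n0 e0]]|S0] := pselect (S x y !=set0).
    apply: (@sub_finite_set _ _ `I_(m0 + n0).+1); last exact: finite_II.
    move=> m [n] /=; rewrite e0 => /eqP; rewrite eqr_nat => /eqP ->.
    by rewrite ltnS leq_addr.
  by rewrite (_ : S x y = set0) //; apply/seteqP; split => // m Sm; case: S0; exists m.
apply: (@sub_finite_set _ _
  (\bigcup_(p in [set` allpairs pair s t]) ((fun m => p.1 + m%:R) @` S p.1 p.2))).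
  move=> a [/sP [x xs [m ax]] /tP [y yt [n cy]]].
  exists (x, y) => /=; first by apply/allpairsP; exists (x, y).
  exists m => //; exists n.
  have -> : c - x - y = c - a + (a - x) - y by ring.
  by rewrite cy ax natrD; ring.
apply: bigcup_finite; first exact: finite_seq.
by move=> p _; exact: finite_image.
Qed.

End Support.

Section Series.
Variables (F : fieldType) (G : numDomainType).

(* Formal sums \sum_a f_a xi^a with exponents in G, supported in finitely many
   half-lines b + N.  For G = int these are the formal Laurent series. *)
Record gseries := GSeries {
  coefs :> G -> F;
  coefsP : admissible [set a | coefs a != 0] }.

Implicit Types f g h : gseries.

HB.instance Definition _ := gen_eqMixin gseries.
HB.instance Definition _ := gen_choiceMixin gseries.

Lemma gseriesP f g : (forall a, f a = g a) -> f = g.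
Proof.
case: f g => f fP [g gP] /= /funext fg; case: _ / fg in gP *.
by congr GSeries; exact: Prop_irrelevance.
Qed.

Definition gsupp f : set G := [set a | f a != 0].

Lemma zero_subproof : admissible [set a : G | (0 : F) != 0].
Proof. by apply: admissible_sub (admissible0 G) => a /=; rewrite eqxx. Qed.
Definition szero := GSeries zero_subproof.

Lemma mono_subproof (k : F) (b : G) :
  admissible [set a : G | (if a == b then k else 0) != 0].
Proof.
apply: admissible_sub (admissible1 b) => a /=.
by case: ifP => [/eqP //|_]; rewrite eqxx.
Qed.
(* k xi^b *)
Definition monom (k : F) (b : G) := GSeries (mono_subproof k b).

Lemma add_subproof f g : admissible [set a | f a + g a != 0].
Proof.
apply: admissible_sub (admissibleU (coefsP f) (coefsP g)) => a /=.
by have [->|?] := eqVneq (f a) 0; [rewrite add0r; right | left].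
Qed.
Definition sadd f g := GSeries (add_subproof f g).

Lemma opp_subproof f : admissible [set a | - f a != 0].
Proof. by apply: admissible_sub (coefsP f) => a /=; rewrite oppr_eq0. Qed.
Definition sopp f := GSeries (opp_subproof f).

Definition conv f g (c : G) : F := \sum_(a \in [set: G]) f a * g (c - a).

Lemma convE f g c (A : set G) : finite_set A ->
  (forall a, f a != 0 -> g (c - a) != 0 -> A a) ->
  conv f g c = \sum_(a \in A) f a * g (c - a).
Proof.
move=> finA AP; symmetry; apply: fsbig_widen => // a [_ nAa] /=.
apply/eqP; apply: contra_notT nAa; rewrite mulf_eq0 negb_or => /andP[].
exact: AP.
Qed.

Lemma conv_neq0 f g c : conv f g c != 0 -> sumset (gsupp f) (gsupp g) c.
Proof.
apply: contra_neqP => nS; apply: fsbig1 => a _.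
apply/eqP; apply: contra_notT nS; rewrite mulf_eq0 negb_or => /andP[fa ga].
by exists a.
Qed.

Lemma mul_subproof f g : admissible [set c | conv f g c != 0].
Proof.
apply: admissible_sub (admissible_sumset (coefsP f) (coefsP g)) => c.
exact: conv_neq0.
Qed.
Definition smul f g := GSeries (mul_subproof f g).

Fact saddA : associative sadd.
Proof. by move=> f g h; apply: gseriesP => a /=; rewrite addrA. Qed.
Fact saddC : commutative sadd.
Proof. by move=> f g; apply: gseriesP => a /=; rewrite addrC. Qed.
Fact sadd0 : left_id szero sadd.
Proof. by move=> f; apply: gseriesP => a /=; rewrite add0r. Qed.
Fact saddN : left_inverse szero sopp sadd.
Proof. by move=> f; apply: gseriesP => a /=; rewrite addNr. Qed.

HB.instance Definition _ := GRing.isZmodule.Build gseries saddA saddC sadd0 saddN.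

Fact smulC : commutative smul.
Proof.
move=> f g; apply: gseriesP => c /=; rewrite /conv.
rewrite (reindex_fsbigT (fun a => c - a)).
  by apply: eq_fsbigr => a _; rewrite subKr mulrC.
by exists (fun a => c - a) => a; rewrite subKr.
Qed.

Fact smul1 : left_id (monom 1 0) smul.
Proof.
move=> f; apply: gseriesP => c /=.
rewrite (@convE _ _ _ [set 0]); last 2 first.
- exact: finite_set1.
- by move=> a /=; have [->|] := eqVneq a 0; rewrite ?eqxx.
by rewrite fsbig_set1 /= eqxx mul1r subr0.
Qed.

Fact smulDl : left_distributive smul sadd.
Proof.
move=> f g h; apply: gseriesP => c /=.
pose A := [set a | (gsupp f `|` gsupp g) a /\ gsupp h (c - a)].
have finA : finite_set A.
  by apply: finite_conv; [apply: admissibleU; exact: coefsP | exact: coefsP].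
rewrite !(@convE _ _ _ A) //; last 3 first.
- by move=> a ga ha; split => //; right.
- by move=> a fa ha; split => //; left.
- move=> a fga ha; split => //; have [f0|] := eqVneq (f a) 0; last by left.
  by right; move: fga; rewrite /= f0 add0r.
by rewrite -fsbig_split //; apply: eq_fsbigr => a _; rewrite /= mulrDl.
Qed.

Fact smulA : associative smul.
Proof.
move=> f g h; apply: gseriesP => c /=.
pose B := [set b | gsupp f b /\ sumset (gsupp g) (gsupp h) (c - b)].
pose A := [set a | sumset (gsupp f) (gsupp g) a /\ gsupp h (c - a)].
have finB : finite_set B.
  by apply: finite_conv; [exact: coefsP |
     apply: admissible_sumset; exact: coefsP].
have finA : finite_set A.
  by apply: finite_conv; [apply: admissible_sumset; exact: coefsP |
     exact: coefsP].
rewrite (@convE f (smul g h) c B) //; last first.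
  by move=> b fb /conv_neq0 ghb; split.
rewrite (@convE (smul f g) h c A) //; last first.
  by move=> a /conv_neq0 fga ha; split.
transitivity (\sum_(b \in B) \sum_(a \in A) f b * (g (a - b) * h (c - a))).
  apply: eq_fsbigr => b; rewrite inE => -[fb _].
  rewrite /= -mulr_fsumr; congr (_ * _); rewrite /conv.
  rewrite (reindex_fsbigT (fun a => a - b)); last first.
    by exists (fun a => a + b) => a; rewrite ?subrK ?addrK.
  symmetry; rewrite [LHS](@fsbig_widen _ _ _ _ _ setT) //; last first.
    move=> a [_ nAa] /=; apply/eqP; apply: contra_notT nAa.
    rewrite mulf_eq0 negb_or => /andP[ga ha]; split => //.
    by exists b.
  by apply: eq_fsbigr => a _; rewrite (_ : c - b - (a - b) = c - a) //; ring.
rewrite exchange_fsbig //; apply: eq_fsbigr => a; rewrite inE => -[_ ha].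
rewrite /= /conv mulr_fsuml.
rewrite [LHS](@fsbig_widen _ _ _ _ _ setT) //.
  by apply: eq_fsbigr => b _; rewrite mulrA.
move=> b [_ nBb] /=; apply/eqP; apply: contra_notT nBb.
rewrite !mulf_eq0 !negb_or => /and3P[fb gb _]; split => //.
exists (a - b) => //; rewrite /gsupp /= (_ : c - b - (a - b) = c - a) //; ring.
Qed.

Fact smul10 : monom 1 0 != 0 :> gseries.
Proof.
by apply/eqP => /(congr1 (fun f : gseries => f 0)) /=; rewrite eqxx; apply/eqP/oner_neq0.
Qed.

HB.instance Definition _ :=
  GRing.Zmodule_isComNzRing.Build gseries smulA smulC smul1 smulDl smul10.

Definition sunit : pred gseries := fun f => `[< exists g, g * f = 1 >].
Definition sinv f : gseries :=
  if pselect (exists g, g * f = 1) is left e then projT1 (cid e) else f.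
Fact smulV : {in sunit, left_inverse 1 sinv *%R}.
Proof.
move=> f; rewrite unfold_in => /asboolP uf; rewrite /sinv; case: pselect => // e.
exact: (projT2 (cid e)).
Qed.
Fact sunitP f g : g * f = 1 -> sunit f.
Proof. by move=> fg; apply/asboolP; exists g. Qed.
Fact sinv_out : {in [predC sunit], sinv =1 id}.
Proof.
move=> f; rewrite inE /= unfold_in => nuf; rewrite /sinv; case: pselect => // uf.
by move/negP: nuf; case; apply/asboolP.
Qed.
HB.instance Definition _ :=
  GRing.ComNzRing_hasMulInverse.Build gseries smulV sunitP sinv_out.

Lemma monomM (k l : F) (a b : G) : monom k a * monom l b = monom (k * l) (a + b).
Proof.
apply: gseriesP => c /=.
rewrite [LHS](@convE _ _ _ [set a]) ?fsbig_set1 //=; last first.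
  by move=> x /=; have [->|] := eqVneq x a; rewrite ?eqxx.
rewrite eqxx subr_eq [b + a]addrC.
by case: ifP => _; rewrite ?mulr0.
Qed.

Definition scal (k : F) : gseries := monom k 0.

Lemma scalM (k l : F) : scal (k * l) = scal k * scal l.
Proof. by rewrite /scal monomM addr0. Qed.

Lemma coef_scalM (k : F) f a : (scal k * f) a = k * f a.
Proof.
rewrite [LHS](@convE _ _ _ [set 0]) ?fsbig_set1 /= ?eqxx ?subr0 //.
by move=> x /=; have [->|] := eqVneq x 0; rewrite ?eqxx.
Qed.

Lemma coefD f g a : (f + g) a = f a + g a. Proof. by []. Qed.

Lemma coef_sum (I : Type) (r : seq I) (P : pred I) (f : I -> gseries) a :
  (\sum_(i <- r | P i) f i) a = \sum_(i <- r | P i) f i a.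
Proof. by elim/big_rec2: _ => //= i x y _ <-. Qed.

End Series.

Arguments scal {F G} k.

Section LoopAlgebras.
Variable R : realType.
Local Notation C := R[i].

Definition laurent := gseries C int.

(* Formal series with complex exponents, a ring containing C((xi)) as well as
   all the fractional powers of xi. *)
Definition cseries := gseries C C.
HB.instance Definition _ := GRing.ComUnitRing.on laurent.
HB.instance Definition _ := GRing.ComUnitRing.on cseries.

Lemma cseries_subproof (f : laurent) :
  admissible [set a : C | \sum_(n \in [set n : int | n%:~R = a]) f n != 0].
Proof.
have [s sP] := coefsP f; exists [seq b%:~R | b <- s] => a /= /eqP sum0.
have [n [<- /sP [b bs [m ->]]]] : exists n : int, n%:~R = a /\ f n != 0.
  apply: contrapT => nex; apply: sum0; apply: fsbig1 => n /= na.
  by apply/eqP; apply: contra_notT nex => fn; exists n.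
exists b%:~R; first exact: map_f.
by exists m; rewrite intrD natz -pmulrn.
Qed.
(* The inclusion of C((xi)); the sum below has at most one term. *)
Definition cseries_of (f : laurent) : cseries := GSeries (cseries_subproof f).

Lemma deriv_subproof (f : laurent) :
  admissible [set n : int | (n + 1)%:~R * f (n + 1) != 0].
Proof.
have [s sP] := coefsP f; exists [seq b - 1 | b <- s] => n /=.
rewrite mulf_eq0 negb_or => /andP[_ /sP [b bs [m nb]]].
exists (b - 1); first exact: map_f.
by exists m; rewrite -[LHS](addrK 1) nb; ring.
Qed.
(* f |-> df / d xi *)
Definition sderiv (f : laurent) : laurent := GSeries (deriv_subproof f).

Definition res (f : laurent) : C := f (- 1).

Definition cexp (z : C) : C :=
  ((expR (complex.Re z) * cos (complex.Im z)) +i*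
   (expR (complex.Re z) * sin (complex.Im z)))%C.

Lemma cexp_neq0 (z : C) : cexp z != 0.
Proof.
apply/negP => /eqP[]; set x := complex.Re z; set y := complex.Im z.
move=> /eqP; rewrite mulf_eq0 gt_eqF ?expR_gt0 //= => /eqP cy.
move=> /eqP; rewrite mulf_eq0 gt_eqF ?expR_gt0 //= => /eqP sy.
have /eqP := cos2Dsin2 y; rewrite cy sy expr0n /= addr0 eq_sym.
by rewrite oner_eq0.
Qed.

(* exp (a ln xi), where ln xi is the k-th branch Ln xi + 2 pi i k of the
   logarithm and the series xi^a stands for exp (a Ln xi). *)
Definition xi_pow (k : int) (a : C) : cseries :=
  monom (cexp (a * (0 +i* (pi *+ 2 *~ k))%C)) a.

Section Matrices.
Variable N : nat.
Local Notation MC := 'M[C]_N.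
Local Notation ML := 'M[laurent]_N.

(* exp (ln xi * mu) for a diagonal matrix mu *)
Definition tau (k : int) (mu : MC) : 'M[cseries]_N :=
  diag_mx (\row_i xi_pow k (mu i i)).

Lemma tau_unit (k : int) (mu : MC) : tau k mu \in unitmx.
Proof.
rewrite unitmxE det_diag; apply: rpred_prod => i _; rewrite mxE /xi_pow.
set e := cexp _; have e0 : e != 0 by exact: cexp_neq0.
apply/unitrP; exists (monom e^-1 (- mu i i)).
by rewrite !monomM mulVf // mulfV // addNr subrr.
Qed.

Definition lie (A : pzRingType) (x y : 'M[A]_N) : 'M[A]_N := x *m y - y *m x.

(* J is the Gram matrix of the invariant form in a basis of weight vectors, so
   that the Cartan subalgebra is diagonal; so_1, so_2, so_4 are not simple. *)
Inductive classical (g : {vspace MC}) : Prop :=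
| TypeA of (1 < N)%N & (forall x, (x \in g) = (\tr x == 0))
| TypeBD (J : MC) of (N == 3%N) || (4 < N)%N & J^T = J & J \in unitmx &
    (forall x, (x \in g) = (x^T *m J + J *m x == 0))
| TypeC (J : MC) of (0 < N)%N & J^T = - J & J \in unitmx &
    (forall x, (x \in g) = (x^T *m J + J *m x == 0)).

Definition cartan_subalgebra (g h : {vspace MC}) : Prop :=
  [/\ (h <= g)%VS,
      (forall x y, x \in h -> y \in h -> lie x y \in h),
      (exists n : nat, forall (s : seq MC) x, size s = n ->
         all (fun y => y \in h) s -> x \in h -> foldr (@lie C) x s = 0)
    & (forall x, x \in g -> (forall y, y \in h -> lie x y \in h) -> x \in h)].

(* The trace of ad x \o ad y on g, for x, y \in g; it is bilinear on all of
   'M_N, where its values outside g are irrelevant. *)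
Definition killing (g : {vspace MC}) (x y : MC) : C :=
  \sum_(i < \dim g) coord (vbasis g) i (lie x (lie y (vbasis g)`_i)).

Section Roots.
Variables g h : {vspace MC}.
Local Notation H := (subvs_of h).
Local Notation Hdual := 'Hom(H, C^o).

Definition root_space (a : Hdual) : set MC :=
  [set x | x \in g /\ forall t : H, lie (vsval t) x = (a t : C) *: x].

Definition is_root (a : Hdual) : Prop :=
  a != 0 /\ exists2 x, root_space a x & x != 0.

Definition coweight (mu : H) : Prop :=
  forall a, is_root a -> exists n : int, a mu = n%:~R.

Definition base (Pi : seq Hdual) : Prop :=
  [/\ (forall a, a \in Pi -> is_root a), basis_of fullv Pi
    & forall b, is_root b -> exists m : Hdual -> nat,
        b = \sum_(a <- Pi) a *+ m a \/ b = - \sum_(a <- Pi) a *+ m a].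

(* The X_a are part of a Chevalley basis, consisting of the X_a for all
   roots a and the coroots [X_a, X_{-a}] for a in a base. *)
Definition chevalley (X : Hdual -> MC) : Prop :=
  [/\ (forall a, is_root a -> root_space a (X a)),
      (forall a, is_root a ->
         exists2 t : H, vsval t = lie (X a) (X (- a)) & a t = 2),
      (forall a b, is_root a -> is_root b -> is_root (a + b) ->
         exists2 k : C, lie (X a) (X b) = k *: X (a + b)
                      & lie (X (- a)) (X (- b)) = - k *: X (- (a + b)))
    & exists Delta Pi : seq Hdual,
        [/\ uniq Delta, (forall a, a \in Delta <-> is_root a), base Pi
          & basis_of g ([seq X a | a <- Delta] ++
                        [seq lie (X a) (X (- a)) | a <- Pi])]].

Definition form (c : C) (x y : MC) : C := c * killing g x y.

Definition form_dual (c : C) (a : Hdual) (t : H) : Prop :=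
  forall s : H, form c (vsval t) (vsval s) = a s.

(* <theta, theta> = 2 for a root theta of maximal length *)
Definition normalized (c : C) : Prop :=
  exists theta t, [/\ is_root theta, form_dual c theta t,
    (forall a s, is_root a -> form_dual c a s ->
       form c (vsval s) (vsval s) <= form c (vsval t) (vsval t))
    & form c (vsval t) (vsval t) = 2].

End Roots.

Definition tens (x : MC) (f : laurent) : ML := f *: map_mx scal x.

(* g (x) C((xi)), inside 'M_N(C) (x) C((xi)) = 'M_N(C((xi))) *)
Definition loop (g : {vspace MC}) : set ML :=
  [set x | exists n (X : 'I_n -> MC) (f : 'I_n -> laurent),
     (forall i, X i \in g) /\ x = \sum_i tens (X i) (f i)].

Definition loop_scale (k : C) (x : ML) : ML := scal k *: x.

(* The C((xi))-bilinear extension of a bilinear form B on 'M_N(C) *)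
Definition form_ext (B : MC -> MC -> C) (x y : ML) : laurent :=
  \sum_(p : 'I_N * 'I_N) \sum_(q : 'I_N * 'I_N)
    scal (B (delta_mx p.1 p.2) (delta_mx q.1 q.2)) * (x p.1 p.2 * y q.1 q.2).

(* X (x) f, Y (x) g |-> B(X, Y) Res (g df) *)
Definition cocycle (B : MC -> MC -> C) (x y : ML) : C :=
  res (form_ext B (map_mx sderiv x) y).

Lemma lie_linearl (z : MC) : linear (fun x => lie x z).
Proof.
move=> k x y; rewrite /lie mulmxDl mulmxDr -scalemxAl -scalemxAr scalerBr.
by rewrite opprD addrACA.
Qed.

Lemma lie_linearr (z : MC) : linear (lie z).
Proof.
move=> k x y; rewrite /lie mulmxDl mulmxDr -scalemxAl -scalemxAr scalerBr.
by rewrite opprD addrACA.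
Qed.

Lemma form_linearl g c z : scalar (fun x => form g c x z).
Proof.
move=> k x y; rewrite /form /killing mulrCA -mulrDr; congr (_ * _).
rewrite mulr_sumr -big_split; apply: eq_bigr => i _ /=.
by rewrite lie_linearl linearP.
Qed.

Lemma form_linearr g c z : scalar (form g c z).
Proof.
move=> k x y; rewrite /form /killing mulrCA -mulrDr; congr (_ * _).
rewrite mulr_sumr -big_split; apply: eq_bigr => i _ /=.
by rewrite lie_linearl lie_linearr linearP.
Qed.

Lemma sderiv_scal (k : C) f : sderiv (f * scal k) = scal k * sderiv f.
Proof.
rewrite [f * _]mulrC; apply: gseriesP => n; rewrite coef_scalM.
change ((n + 1)%:~R * coefs (scal k * f) (n + 1) =
        k * ((n + 1)%:~R * coefs f (n + 1))).
by rewrite coef_scalM mulrCA.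
Qed.

Lemma scalar_sum_delta (l : MC -> C) (x : MC) : scalar l ->
  l x = \sum_(p : 'I_N * 'I_N) x p.1 p.2 * l (delta_mx p.1 p.2).
Proof.
move=> lP.
pose L := HB.pack_for {scalar MC} l (GRing.isLinear.Build _ _ _ _ l lP).
have -> : l x = L x by [].
rewrite {1}[x]matrix_sum_delta pair_bigA linear_sum.
by apply: eq_bigr => p _; rewrite linearZ.
Qed.

Lemma cocycle_tens g c x y f1 f2 :
  cocycle (form g c) (tens x f1) (tens y f2) = form g c x y * res (f2 * sderiv f1).
Proof.
rewrite /cocycle /res /form_ext !coef_sum (scalar_sum_delta x (form_linearl g c y)).
rewrite mulr_suml; apply: eq_bigr => p _; rewrite coef_sum.
rewrite (scalar_sum_delta y (form_linearr g c (delta_mx p.1 p.2))).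
rewrite [x _ _ * _]mulr_sumr mulr_suml.
apply: eq_bigr => q _.
rewrite !mxE sderiv_scal -!coef_scalM !scalM; congr (coefs _ _).
by rewrite [f2 * scal _]mulrC; ring.
Qed.

(* (x, k) stands for x + k c; the first projection is the quotient by C c *)
Definition affine (g : {vspace MC}) : set (ML * C) := [set u | loop g u.1].

Definition affine_scale (k : C) (u : ML * C) : ML * C :=
  (loop_scale k u.1, k * u.2).

Definition affine_lie (B : MC -> MC -> C) (u v : ML * C) : ML * C :=
  (lie u.1 v.1, cocycle B u.1 v.1).

Definition lie_automorphism (V : zmodType) (A : set V) (scale : C -> V -> V)
    (bracket : V -> V -> V) (s : V -> V) : Prop :=
  [/\ set_bij A A s,
      {in A &, {morph s : x y / x + y}},
      (forall k, {in A, {morph s : x / scale k x}})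
    & {in A &, {morph s : x y / bracket x y}}].

Definition single_shift (g h : {vspace MC}) (c : C)
    (X : 'Hom(subvs_of h, C^o) -> MC) (mu : subvs_of h)
    (s : ML * C -> ML * C) : Prop :=
  [/\ lie_automorphism (affine g) affine_scale (affine_lie (form g c)) s,
      s (0, 1) = (0, 1),
      (forall x f, x \in h ->
         s (tens x f, 0) =
         (tens x f, form g c (vsval mu) x * res (monom 1 (- 1) * f)))
    & (forall a (n : int) f, is_root g a -> a mu = n%:~R ->
         s (tens (X a) f, 0) = (tens (X a) (monom 1 n * f), 0))].

End Matrices.
End LoopAlgebras.

(* Main.v *)
(* Conjugation by tau_mu multiplies the (i, j) entry by xi^(mu_i - mu_j).  A
   Chevalley basis spans g by eigenvectors of ad mu, with integral eigenvalues
   because mu is a coweight; an eigenvector x for n has entries only where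
   mu_i - mu_j = n, so that x (x) f goes to x (x) xi^n f.  Everything is checked
   on such tensors by (bi)additivity.
   The lift to the central extension adds <mu, x> Res(xi^-1 f dxi) c to the image
   of x (x) f.  It respects the cocycle because the derivative of xi^n produces
   n <x, y> = <[mu, x], y> = <mu, [x, y]>, eigenspaces of ad mu whose eigenvalues
   do not cancel being orthogonal for the invariant form.  It is the single shift
   because root vectors are orthogonal to h. *)
From HB Require Import structures.
From mathcomp Require Import all_boot all_order all_algebra.
From mathcomp Require Import complex ring.
From mathcomp Require Import all_classical all_reals all_analysis.
Require Import Defs.

Set Implicit Arguments.
Unset Strict Implicit.
Unset Printing Implicit Defensive.

Import Order.TTheory GRing.Theory Num.Theory.

Local Open Scope classical_set_scope.
Local Open Scope ring_scope.

(** * Constants and monomials in the rings of formal series *)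

Section ScalarSeries.
Variables (F : fieldType) (G : numDomainType).
Implicit Types (k : F) (a b : G) (f g : gseries F G).

Lemma coef_monomM k b f a : (monom k b * f) a = k * f (a - b).
Proof.
rewrite [LHS](@convE _ _ _ _ _ [set b]) ?fsbig_set1 /= ?eqxx //.
by move=> x /=; have [->|] := eqVneq x b; rewrite ?eqxx.
Qed.

Fact scal_is_zmod_morphism : zmod_morphism (@scal F G).
Proof.
move=> k l; apply: gseriesP => a /=.
by case: ifP => _; rewrite ?subr0.
Qed.

Fact scal_is_monoid_morphism : monoid_morphism (@scal F G).
Proof. by split=> // k l; exact: scalM. Qed.

HB.instance Definition _ :=
  GRing.isZmodMorphism.Build F (gseries F G) (@scal F G) scal_is_zmod_morphism.
HB.instance Definition _ :=
  GRing.isMonoidMorphism.Build F (gseries F G) (@scal F G)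
    scal_is_monoid_morphism.

End ScalarSeries.


(** * Bracket identities, closure of the classical algebras, invariance of the Killing form *)

Lemma jacobi (A : comPzRingType) n (x y z : 'M[A]_n) :
  lie (lie x y) z = lie x (lie y z) - lie y (lie x z).
Proof.
rewrite /lie !mulmxBl !mulmxBr !mulmxA.
(* With the six triple products made opaque, the identity is additive and can be checked entrywise
   by [ring]. *)
move: (x *m y *m z) (y *m x *m z) (z *m x *m y) (z *m y *m x) (x *m z *m y)
  (y *m z *m x) => a b c d e f.
by apply/matrixP => i j; rewrite !mxE; ring.
Qed.

Lemma mxtrace_lie_mulmx (A : comPzRingType) n (x y z : 'M[A]_n) :
  \tr (lie x y *m z) = \tr (x *m lie y z).
Proof.
rewrite /lie mulmxBl mulmxBr !raddfB /= !mulmxA; congr (_ - _).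
by rewrite [RHS]mxtrace_mulC mulmxA.
Qed.

Section TraceForm.
Variables (F : fieldType) (N : nat).
Implicit Types (g : {vspace 'M[F]_N}) (x y z : 'M[F]_N).

Definition lie_closed g := forall x y, x \in g -> y \in g -> lie x y \in g.

(** When [lie x] preserves [g], this is the matrix of ad x on [g] in the basis [vbasis g]. *)
Definition ad_mx g x : 'M[F]_(\dim g) :=
  \matrix_(i, j) coord (vbasis g) i (lie x (vbasis g)`_j).

Fact lie_is_linear x : linear (lie x).
Proof.
move=> k y z; rewrite /lie mulmxDl mulmxDr -scalemxAl -scalemxAr scalerBr.
by rewrite opprD addrACA.
Qed.

HB.instance Definition _ x :=
  GRing.isLinear.Build F 'M[F]_N 'M[F]_N _ (lie x) (lie_is_linear x).

Lemma coord_lie g x z i : z \in g ->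
  coord (vbasis g) i (lie x z) =
  \sum_j ad_mx g x i j * coord (vbasis g) j z.
Proof.
move=> zg; rewrite {1}(coord_vbasis zg) linear_sum linear_sum.
by apply: eq_bigr => j _; rewrite !linearZ mxE mulrC.
Qed.

Lemma vbasis_nth_mem g (i : 'I_(\dim g)) : (vbasis g)`_i \in g.
Proof. by apply/vbasis_mem/mem_nth; rewrite size_tuple. Qed.

Lemma ad_mx_mulmx g x y i j : lie_closed g -> y \in g ->
  (ad_mx g x *m ad_mx g y) i j =
  coord (vbasis g) i (lie x (lie y (vbasis g)`_j)).
Proof.
move=> gL yg; rewrite coord_lie ?gL ?vbasis_nth_mem // mxE.
by apply: eq_bigr => l _; rewrite [ad_mx g y l j]mxE.
Qed.

Lemma ad_mx_lie g x y : lie_closed g -> x \in g -> y \in g ->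
  ad_mx g (lie x y) = lie (ad_mx g x) (ad_mx g y).
Proof.
move=> gL xg yg; apply/matrixP => i j.
rewrite [LHS]mxE jacobi linearB /= -!ad_mx_mulmx //.
by rewrite /lie [RHS]mxE [X in _ = _ + X]mxE.
Qed.

(** Since [g] is closed under the bracket, both sums are traces of products of matrices of ad, and
    ad turns brackets into commutators. Invariance is then cyclicity of the trace. *)
Lemma trace_form_invariant g x y z : lie_closed g ->
  x \in g -> y \in g -> z \in g ->
  \sum_(i < \dim g)
    coord (vbasis g) i (lie (lie x y) (lie z (vbasis g)`_i)) =
  \sum_(i < \dim g)
    coord (vbasis g) i (lie x (lie (lie y z) (vbasis g)`_i)).
Proof.
move=> gL xg yg zg.
under eq_bigr do rewrite -ad_mx_mulmx //.
under [RHS]eq_bigr do rewrite -ad_mx_mulmx ?gL //.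
by rewrite !ad_mx_lie // -!/(mxtrace _) mxtrace_lie_mulmx.
Qed.

End TraceForm.

(** The relation x^T J = - J x, used twice, gives (x y)^T J = y^T x^T J = J y x; antisymmetrizing in
    x and y yields the relation for the commutator. *)
Lemma lie_closed_invariants (F : fieldType) N (J : 'M[F]_N)
    (g : {vspace 'M[F]_N}) :
  (forall x, (x \in g) = (x^T *m J + J *m x == 0)) -> lie_closed g.
Proof.
move=> gP x y; rewrite !gP !addr_eq0 => /eqP xJ /eqP yJ; apply/eqP.
rewrite /lie linearB /= !trmx_mul mulmxBl mulmxBr -!mulmxA xJ yJ.
by rewrite !mulmxN !mulmxA xJ yJ !mulNmx !opprK opprB.
Qed.

Lemma lie_closed_sl (F : fieldType) N (g : {vspace 'M[F]_N}) :
  (forall x, (x \in g) = (\tr x == 0)) -> lie_closed g.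
Proof.
by move=> gP x y _ _; rewrite gP /lie linearB /= mxtrace_mulC subrr.
Qed.

Lemma classical_lie_closed (R : realType) N (g : {vspace 'M[R[i]]_N}) :
  classical g -> lie_closed g.
Proof.
case=> [_ gP|J _ _ _ gP|J _ _ _ gP].
- exact: lie_closed_sl.
- exact: lie_closed_invariants gP.
- exact: lie_closed_invariants gP.
Qed.

Lemma form_invariant (R : realType) N (g : {vspace 'M[R[i]]_N}) (c : R[i])
    x y z : lie_closed g -> x \in g -> y \in g -> z \in g ->
  form g c (lie x y) z = form g c x (lie y z).
Proof.
move=> gL xg yg zg.
exact: (congr1 (fun t => c * t) (trace_form_invariant gL xg yg zg)).
Qed.

(** * Pure tensors and induction on the loop algebra *)

Section Tensors.
Variables (R : realType) (N : nat).
Local Notation C := R[i].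
Local Notation MC := 'M[C]_N.
Local Notation ML := 'M[laurent R]_N.
Implicit Types (g : {vspace MC}) (x y z : MC) (f : laurent R).

Lemma tensE x f i j : tens x f i j = f * scal (x i j).
Proof. by rewrite !mxE. Qed.

Lemma tensZ (k : C) x f : tens (k *: x) f = tens x (scal k * f).
Proof.
by apply/matrixP => i j; rewrite !tensE mxE rmorphM /= mulrCA mulrA.
Qed.

Lemma tens_suml n (F : 'I_n -> MC) f :
  tens (\sum_i F i) f = \sum_i tens (F i) f.
Proof.
apply/matrixP => i j; rewrite tensE !summxE rmorph_sum mulr_sumr.
by apply: eq_bigr => l _; rewrite tensE.
Qed.

Lemma lie_tens x y f1 f2 :
  lie (tens x f1) (tens y f2) = tens (lie x y) (f1 * f2).
Proof.
rewrite /lie /tens -!scalemxAl -!scalemxAr !scalerA -!map_mxM map_mxB.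
by rewrite scalerBr [f2 * f1]mulrC.
Qed.

Lemma loop_tens g x f : x \in g -> loop g (tens x f).
Proof.
by move=> xg; exists 1%N, (fun=> x), (fun=> f); rewrite big_ord1.
Qed.

Lemma loopD g (u v : ML) : loop g u -> loop g v -> loop g (u + v).
Proof.
move=> [n [Y [F [Yg ->]]]] [m [Z [H [Zg ->]]]]; exists (n + m)%N.
exists (fun i => match fintype.split i with inl j => Y j | inr j => Z j end).
exists (fun i => match fintype.split i with inl j => F j | inr j => H j end).
split=> [i|]; first by case: fintype.split.
rewrite big_split_ord; congr (_ + _); apply: eq_bigr => i _.
  by rewrite (unsplitK (inl i)).
by rewrite (unsplitK (inr i)).
Qed.

Lemma loop0 g : loop g 0.
Proof. by exists 0%N, (fun=> 0), (fun=> 0); rewrite big_ord0; split=> // -[]. Qed.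

Lemma loop_sum g n (F : 'I_n -> ML) :
  (forall i, loop g (F i)) -> loop g (\sum_i F i).
Proof. by move=> gF; elim/big_rec: _ => [|i u _]; [exact: loop0|exact: loopD]. Qed.

(** Coefficients over [s] are absorbed into the series by [tensZ], so the tensors x (x) f with x in
    [s] already generate the loop algebra as an additive group. *)
Lemma loop_span_ind g (s : seq MC) (P : ML -> Prop) :
  (g <= span s)%VS -> P 0 -> (forall u v, P u -> P v -> P (u + v)) ->
  (forall x f, x \in s -> P (tens x f)) -> forall u, loop g u -> P u.
Proof.
move=> /subvP gs P0 PD Ps _ [n [Y [F [Yg ->]]]].
elim/big_rec: _ => // i u _; apply: (PD).
rewrite (coord_span (X := in_tuple s) (gs _ (Yg i))) tens_suml.
elim/big_rec: _ => // j v _; apply: (PD).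
by rewrite tensZ; apply: Ps; exact: mem_nth.
Qed.

Lemma loop_scale_tens (k : C) x f :
  loop_scale k (tens x f) = tens x (scal k * f).
Proof. by rewrite /loop_scale /tens scalerA. Qed.

Lemma loop_loop_scale g (k : C) u : loop g u -> loop g (loop_scale k u).
Proof.
move=> [n [Y [F [Yg ->]]]]; rewrite /loop_scale scaler_sumr.
by apply: loop_sum => i; rewrite -/(loop_scale _ _) loop_scale_tens; exact: loop_tens.
Qed.

End Tensors.

(** * Weights of a diagonal matrix and orthogonality of weight spaces *)

Lemma lieC (A : pzRingType) n (x y : 'M[A]_n) : lie x y = - lie y x.
Proof. by rewrite /lie opprB. Qed.

Lemma lieDl (A : pzRingType) n (x y z : 'M[A]_n) :
  lie (x + y) z = lie x z + lie y z.
Proof. by rewrite /lie mulmxDl mulmxDr opprD addrACA. Qed.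

Lemma lieDr (A : pzRingType) n (x y z : 'M[A]_n) :
  lie z (x + y) = lie z x + lie z y.
Proof. by rewrite /lie mulmxDl mulmxDr opprD addrACA. Qed.

Section DiagonalAction.
Variables (F : fieldType) (N : nat).
Implicit Types (d x y : 'M[F]_N).

Lemma lie_diagE d x i j : is_diag_mx d ->
  lie d x i j = (d i i - d j j) * x i j.
Proof.
move=> /diag_mxP[r ->]; rewrite /lie mul_diag_mx mul_mx_diag !mxE !eqxx !mulr1n.
by rewrite mulrBl [x i j * _]mulrC.
Qed.

Lemma lie_diag_diag d x : is_diag_mx d -> is_diag_mx x -> lie d x = 0.
Proof.
move=> dD /is_diag_mxP xD; apply/matrixP => i j; rewrite lie_diagE // mxE.
by have [->|ij] := eqVneq i j; rewrite ?subrr ?mul0r // xD ?mulr0.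
Qed.

(** By the Jacobi identity ad d is a derivation of the bracket, so eigenvalues add. *)
Lemma lie_lie_eigen d x y (a b : F) : lie d x = a *: x -> lie d y = b *: y ->
  lie d (lie x y) = (a + b) *: lie x y.
Proof.
move=> dx dy; have -> : lie d (lie x y) = lie (lie d x) y + lie x (lie d y).
  by rewrite jacobi subrK.
rewrite dx dy linearZ scalerDl; congr (_ + _).
by rewrite /lie -scalemxAl -scalemxAr scalerBr.
Qed.

End DiagonalAction.

Section FormEigen.
Variables (R : realType) (N : nat).
Local Notation C := R[i].
Variables (g : {vspace 'M[C]_N}) (c : C).
Implicit Types (t x y z : 'M[C]_N).
Local Notation B := (form g c).

Lemma formZl k x z : B (k *: x) z = k * B x z.
Proof.
(* Homogeneity follows from linearity at k x = (k - 1) x + x. *)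
have := form_linearl g c z (k - 1) x x.
by rewrite -{2}[x]scale1r -scalerDl mulrBl !subrK mul1r subrK.
Qed.

Lemma formZr k x z : B z (k *: x) = k * B z x.
Proof.
have := form_linearr g c z (k - 1) x x.
by rewrite -{2}[x]scale1r -scalerDl mulrBl !subrK mul1r subrK.
Qed.

(** Invariance moves t across the form: a B(x, y) = B([t, x], y) = - B(x, [t, y]) = - b B(x, y). *)
Lemma form_eigen_orthogonal t x y (a b : C) : lie_closed g ->
  t \in g -> x \in g -> y \in g -> lie t x = a *: x -> lie t y = b *: y ->
  (a + b) * B x y = 0.
Proof.
move=> gL tg xg yg tx ty; rewrite mulrDl -formZl -formZr -tx -ty.
by rewrite lieC -scaleN1r formZl form_invariant // mulN1r addNr.
Qed.

End FormEigen.

(** * The cocycle and its change under a shift of exponents *)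

Section Cocycle.
Variables (R : realType) (N : nat).
Local Notation C := R[i].
Local Notation MC := 'M[C]_N.
Local Notation ML := 'M[laurent R]_N.
Implicit Types (B : MC -> MC -> C) (g : {vspace MC}) (c : C) (x y : MC).
Implicit Types (u v w : ML) (f : laurent R).

Lemma form_extDl B u v w : form_ext B (u + v) w = form_ext B u w + form_ext B v w.
Proof.
rewrite /form_ext -big_split; apply: eq_bigr => p _; rewrite -big_split.
by apply: eq_bigr => q _; rewrite mxE mulrDl mulrDr.
Qed.

Lemma form_extDr B u v w : form_ext B w (u + v) = form_ext B w u + form_ext B w v.
Proof.
rewrite /form_ext -big_split; apply: eq_bigr => p _; rewrite -big_split.
by apply: eq_bigr => q _; rewrite mxE !mulrDr.
Qed.

Lemma form_extZr B f u w : form_ext B w (f *: u) = f * form_ext B w u.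
Proof.
rewrite /form_ext mulr_sumr; apply: eq_bigr => p _; rewrite mulr_sumr.
by apply: eq_bigr => q _; rewrite mxE [RHS]mulrCA; congr (_ * _); rewrite mulrCA.
Qed.

Lemma form_ext_tens g c x y f1 f2 :
  form_ext (form g c) (tens x f1) (tens y f2) = scal (form g c x y) * (f1 * f2).
Proof.
rewrite /form_ext (scalar_sum_delta x (form_linearl g c y)) rmorph_sum mulr_suml.
apply: eq_bigr => p _.
rewrite (scalar_sum_delta y (form_linearr g c (delta_mx p.1 p.2))).
rewrite mulr_sumr rmorph_sum mulr_suml; apply: eq_bigr => q _.
rewrite !tensE !rmorphM /=.
by move: (scal _) (scal _) (scal _) => k l m; ring.
Qed.

Lemma sderivD f1 f2 : sderiv (f1 + f2) = sderiv f1 + sderiv f2.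
Proof. by apply: gseriesP => n; rewrite coefD /= mulrDr. Qed.

Lemma cocycleDl B u v w : cocycle B (u + v) w = cocycle B u w + cocycle B v w.
Proof.
rewrite /cocycle -coefD -form_extDl; congr (res (form_ext B _ w)).
by apply/matrixP => i j; rewrite !mxE sderivD.
Qed.

Lemma cocycleDr B u v w : cocycle B w (u + v) = cocycle B w u + cocycle B w v.
Proof. by rewrite /cocycle form_extDr. Qed.

Lemma coef_sderiv f (m : int) : sderiv f m = (m + 1)%:~R * f (m + 1).
Proof. by []. Qed.

(** Leibniz rule, with the derivative of xi^n written as n xi^-1 xi^n: the factor xi^-1 is the one
    occurring in [twist]. *)
Lemma sderiv_monomM (n : int) f :
  sderiv (monom 1 n * f) =
  monom 1 n * sderiv f + scal n%:~R * (monom 1 (- 1) * (monom 1 n * f)).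
Proof.
apply: gseriesP => m; rewrite coef_sderiv [RHS]coefD [X in _ = _ + X]coef_scalM.
rewrite [in LHS]coef_monomM 2!coef_monomM coef_sderiv coef_monomM !mul1r.
by rewrite [m - n + 1]addrAC -mulrDl -intrD subrK.
Qed.

Lemma res_scalM (k : C) f : res (scal k * f) = k * res f.
Proof. exact: coef_scalM. Qed.

Lemma resD f1 f2 : res (f1 + f2) = res f1 + res f2.
Proof. by []. Qed.

(* The coefficient of c in the image of u under the single shift by mu. *)
Definition twist g c mu u : C :=
  res (monom 1 (- 1) * form_ext (form g c) (tens mu 1) u).

Lemma twist_tens g c mu x f :
  twist g c mu (tens x f) = form g c mu x * res (monom 1 (- 1) * f).
Proof. by rewrite /twist form_ext_tens mul1r mulrCA res_scalM. Qed.

Lemma twistD g c mu u v : twist g c mu (u + v) = twist g c mu u + twist g c mu v.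
Proof. by rewrite /twist form_extDr mulrDr resD. Qed.

Lemma twist0 g c mu : twist g c mu 0 = 0.
Proof. by apply: (addrI (twist g c mu 0)); rewrite -twistD !addr0. Qed.

Lemma twistZ g c mu (k : C) u :
  twist g c mu (loop_scale k u) = k * twist g c mu u.
Proof. by rewrite /twist form_extZr mulrCA res_scalM. Qed.

(* Either the weights cancel, so that xi^m and xi^n cancel up to the derivative
   of xi^m, or both sides vanish by orthogonality of weight spaces. *)
Lemma cocycle_shift_tens g c mu x y (m n : int) f1 f2 : lie_closed g ->
  mu \in g -> x \in g -> y \in g ->
  lie mu x = m%:~R *: x -> lie mu y = n%:~R *: y ->
  cocycle (form g c) (tens x (monom 1 m * f1)) (tens y (monom 1 n * f2)) =
  cocycle (form g c) (tens x f1) (tens y f2) +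
  twist g c mu (lie (tens x f1) (tens y f2)).
Proof.
move=> gL mug xg yg mux muy; have := form_eigen_orthogonal c gL mug xg yg mux muy.
rewrite lie_tens twist_tens -form_invariant // mux formZl !cocycle_tens.
move/eqP; rewrite mulf_eq0 => /orP[|/eqP ->]; last by rewrite !(mulr0, mul0r) addr0.
rewrite -intrD intr_eq0 => /eqP mn0.
have mono_mn : monom (1 : C) m * monom 1 n = 1 by rewrite monomM mn0 mulr1.
suff -> : monom 1 n * f2 * sderiv (monom 1 m * f1) =
    f2 * sderiv f1 + scal m%:~R * (monom 1 (- 1) * (f1 * f2)).
  by rewrite resD res_scalM mulrDr; congr (_ + _); rewrite mulrCA mulrA.
rewrite sderiv_monomM; transitivity (monom 1 m * monom 1 n *
  (f2 * sderiv f1 + scal m%:~R * (monom 1 (- 1) * (f1 * f2)))).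
  by ring.
by rewrite mono_mn mul1r.
Qed.

End Cocycle.

(** * The shift of the loop algebra and its lift to the central extension *)

Section Shift.
Variables (R : realType) (N : nat).
Local Notation C := R[i].
Local Notation MC := 'M[C]_N.
Local Notation ML := 'M[laurent R]_N.
Implicit Types (mu x y : MC) (u v w : ML) (f : laurent R) (z : C).

(* xi^z for an integer z, and 0 for the other complex numbers z, at which the
   conjugation by tau mu never has to be evaluated on g (x) C((xi)). *)
Definition xi_int z : laurent R :=
  if pselect (exists n : int, z = n%:~R) is left e then monom 1 (projT1 (cid e))
  else 0.

Lemma xi_intE (n : int) : xi_int n%:~R = monom 1 n.
Proof.
rewrite /xi_int; case: pselect => [e|[]]; last by exists n.
by have /intr_inj <- := projT2 (cid e).
Qed.

(** Conjugation by [tau mu], carried out entrywise inside the Laurent series; [map_loop_shift]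
    compares the two on the loop algebra. *)
Definition loop_shift mu u : ML :=
  \matrix_(i, j) (xi_int (mu i i - mu j j) * u i j).

Lemma loop_shiftE mu u i j :
  loop_shift mu u i j = xi_int (mu i i - mu j j) * u i j.
Proof. by rewrite mxE. Qed.

Lemma loop_shift0 mu : loop_shift mu 0 = 0.
Proof. by apply/matrixP => i j; rewrite loop_shiftE mxE mulr0. Qed.

Lemma loop_shiftD mu u v : loop_shift mu (u + v) = loop_shift mu u + loop_shift mu v.
Proof.
apply/matrixP => i j; rewrite [RHS]mxE !loop_shiftE -mulrDr.
by congr (_ * _); exact: mxE.
Qed.

Lemma loop_shiftZ mu f u : loop_shift mu (f *: u) = f *: loop_shift mu u.
Proof.
apply/matrixP => i j; rewrite [RHS]mxE !loop_shiftE mulrCA.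
by congr (_ * _); exact: mxE.
Qed.

Lemma eigen_entry mu x z i j : is_diag_mx mu -> lie mu x = z *: x ->
  x i j != 0 -> mu i i - mu j j = z.
Proof.
move=> muD /matrixP /(_ i j); rewrite lie_diagE // [RHS]mxE => + xij.
exact: mulIf.
Qed.

Lemma loop_shift_tens mu x (n : int) f : is_diag_mx mu ->
  lie mu x = n%:~R *: x -> loop_shift mu (tens x f) = tens x (monom 1 n * f).
Proof.
move=> muD mux; apply/matrixP => i j; rewrite loop_shiftE !tensE.
(* A zero entry says nothing about mu_i - mu_j, but stays zero whatever factor multiplies it. *)
have [->|xij] := eqVneq (x i j) 0; first by rewrite rmorph0 !mulr0.
by rewrite (eigen_entry muD mux xij) xi_intE mulrA.
Qed.

Section WeightBasis.
Variables (g : {vspace MC}) (c : C) (mu : MC) (s : seq MC).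
Hypotheses (gL : lie_closed g) (mug : mu \in g) (muD : is_diag_mx mu).
Hypotheses (gs : (g <= span s)%VS) (sg : {subset s <= g}).
Hypothesis weight_s : forall x, x \in s -> exists n : int, lie mu x = n%:~R *: x.

Local Notation sh := (loop_shift mu).
Local Notation B := (form g c).

Lemma loop_shift_loop u : loop g u -> loop g (sh u).
Proof.
move: u; apply: (loop_span_ind gs) => [|v w|x f xs].
- by rewrite loop_shift0; exact: loop0.
- by rewrite loop_shiftD; exact: loopD.
- have [n mux] := weight_s xs.
  by rewrite (loop_shift_tens _ muD mux); exact/loop_tens/sg.
Qed.

(** Reduces identities in two variables to pure tensors of weight vectors, by [loop_span_ind] in one
    variable after the other. *)
Lemma loop_biadditive_eq (V : zmodType) (F G : ML -> ML -> V) :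
  (forall v, {morph F^~ v : x y / x + y}) -> (forall u, {morph F u : x y / x + y}) ->
  (forall v, {morph G^~ v : x y / x + y}) -> (forall u, {morph G u : x y / x + y}) ->
  (forall x y f1 f2, x \in s -> y \in s ->
     F (tens x f1) (tens y f2) = G (tens x f1) (tens y f2)) ->
  forall u v, loop g u -> loop g v -> F u v = G u v.
Proof.
move=> FDl FDr GDl GDr FGs u v gu gv.
have add0 (H : ML -> V) : {morph H : x y / x + y} -> H 0 = 0.
  by move=> HD; apply: (addrI (H 0)); rewrite -HD !addr0.
move: u gu; apply: (loop_span_ind gs) => [|u1 u2 e1 e2|x f1 xs].
- by rewrite (add0 _ (FDl v)) (add0 _ (GDl v)).
- by rewrite FDl GDl e1 e2.
move: v gv; apply: (loop_span_ind gs) => [|v1 v2 e1 e2|y f2 ys].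
- by rewrite (add0 _ (FDr _)) (add0 _ (GDr _)).
- by rewrite FDr GDr e1 e2.
exact: FGs.
Qed.

Lemma loop_shift_lie u v : loop g u -> loop g v ->
  sh (lie u v) = lie (sh u) (sh v).
Proof.
move: u v; apply: (@loop_biadditive_eq _ (fun u v => sh (lie u v))
  (fun u v => lie (sh u) (sh v))) => [v x y|u x y|v x y|u x y|x y f1 f2 xs ys].
- by rewrite lieDl loop_shiftD.
- by rewrite lieDr loop_shiftD.
- by rewrite loop_shiftD lieDl.
- by rewrite loop_shiftD lieDr.
(* The bracket has weight m + n, matching xi^m xi^n = xi^(m + n). *)
have [m mux] := weight_s xs; have [n muy] := weight_s ys.
have muxy := lie_lie_eigen mux muy; rewrite -intrD in muxy.
rewrite (loop_shift_tens _ muD mux) (loop_shift_tens _ muD muy) !lie_tens.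
by rewrite (loop_shift_tens _ muD muxy) mulrACA monomM mulr1.
Qed.

(** The change of the cocycle is exactly the twist of the bracket, which makes [affine_shift]
    compatible with brackets. *)
Lemma cocycle_shift u v : loop g u -> loop g v ->
  cocycle B (sh u) (sh v) = cocycle B u v + twist g c mu (lie u v).
Proof.
move: u v; apply: (@loop_biadditive_eq _ (fun u v => cocycle B (sh u) (sh v))
  (fun u v => cocycle B u v + twist g c mu (lie u v)))
  => [v x y|u x y|v x y|u x y|x y f1 f2 xs ys].
- by rewrite loop_shiftD cocycleDl.
- by rewrite loop_shiftD cocycleDr.
- by rewrite lieDl twistD cocycleDl addrACA.
- by rewrite lieDr twistD cocycleDr addrACA.
have [m mux] := weight_s xs; have [n muy] := weight_s ys.
rewrite (loop_shift_tens _ muD mux) (loop_shift_tens _ muD muy).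
by apply: cocycle_shift_tens => //; exact: sg.
Qed.

(** Guarantees that the default value of [xi_int] only ever multiplies zero entries of elements of
    the loop algebra. *)
Lemma loop_entry_integral u i j : loop g u -> u i j != 0 ->
  exists n : int, mu i i - mu j j = n%:~R.
Proof.
move: u; apply: (loop_span_ind gs) => [|v w v0 w0|x f xs].
- by rewrite mxE eqxx.
- rewrite mxE; have [vij0|/v0 //] := eqVneq (v i j) 0.
  by rewrite vij0 add0r.
have [n mux] := weight_s xs.
rewrite tensE; have [->|xij _] := eqVneq (x i j) 0.
  by rewrite rmorph0 mulr0 eqxx.
by exists n; exact: eigen_entry muD mux xij.
Qed.

Lemma loop_shift_inj : set_inj (loop g) sh.
Proof.
move=> u v; rewrite !inE => gu gv /matrixP uv; apply/matrixP => i j.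
move: (uv i j); rewrite !loop_shiftE.
have [[n ->]|nint] := pselect (exists n : int, mu i i - mu j j = n%:~R).
  rewrite xi_intE => /(congr1 ( *%R (monom 1 (- n)))).
  by rewrite !mulrA monomM mulr1 addNr !mul1r.
(* At a non-integral difference the shift kills the entry, but elements of the loop algebra have
   none there to lose. *)
have entry0 w : loop g w -> w i j = 0.
  by move=> gw; apply/eqP; apply: contra_notT nint; exact: loop_entry_integral.
by rewrite !entry0.
Qed.

(** Being a value of the shift is stable under sums, so preimages of generators suffice: x (x) xi^-n
    f is sent to x (x) f when x has weight n. *)
Lemma loop_shift_surj : set_surj (loop g) (loop g) sh.
Proof.
apply: (loop_span_ind gs).
- by exists 0; [exact: loop0|rewrite loop_shift0].
- move=> _ _ [u gu <-] [v gv <-]; exists (u + v); first exact: loopD.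
  by rewrite loop_shiftD.
move=> x f xs; have [n mux] := weight_s xs; exists (tens x (monom 1 (- n) * f)).
  exact/loop_tens/sg.
by rewrite (loop_shift_tens _ muD mux) mulrA monomM mulr1 subrr mul1r.
Qed.

Lemma loop_shift_automorphism :
  lie_automorphism (loop g) (@loop_scale R N) (@lie N (laurent R)) sh.
Proof.
split=> [|u v _ _|k u _|u v].
- split; [exact: loop_shift_loop|exact: loop_shift_inj|exact: loop_shift_surj].
- exact: loop_shiftD.
- exact: loop_shiftZ.
- by rewrite !inE; exact: loop_shift_lie.
Qed.

Definition affine_shift (p : ML * C) : ML * C :=
  (sh p.1, p.2 + twist g c mu p.1).

Lemma affine_shift_automorphism :
  lie_automorphism (affine g) (@affine_scale R N) (affine_lie B) affine_shift.
Proof.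
split=> [|[u k] [v l] _ _|k [u l] _|[u k] [v l]].
- split=> [[u k]|[u k] [v l]|[v l] gv]; first exact: loop_shift_loop.
    rewrite !inE => gu gv [/loop_shift_inj uv].
    by rewrite uv ?inE // => /addIr ->.
  have [u gu uv] := loop_shift_surj gv.
  by exists (u, l - twist g c mu u) => //; rewrite /affine_shift /= uv subrK.
- by rewrite /affine_shift /= loop_shiftD twistD addrACA.
- by rewrite /affine_shift /affine_scale /= loop_shiftZ twistZ mulrDr.
- rewrite !inE => gu gv; rewrite /affine_shift /affine_lie /=.
  by rewrite loop_shift_lie // cocycle_shift.
Qed.

End WeightBasis.

(** * Comparison with conjugation by [tau], in series with complex exponents *)

Lemma coef_cseries_of f z :
  cseries_of f z = if pselect (exists n : int, n%:~R = z) is left e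
                   then f (projT1 (cid e)) else 0.
Proof.
rewrite /=; case: pselect => [e|ne]; last first.
  by rewrite fsbig1 // => n nz; case: ne; exists n.
case: cid => m /= <-.
(* The integers embed in the complex numbers, so the defining sum has a single term. *)
rewrite (_ : [set n : int | n%:~R = m%:~R] = [set m]) ?fsbig_set1 //.
by apply/seteqP; split=> n /= => [/intr_inj|->].
Qed.

Lemma cseries_of_intr f (n : int) : cseries_of f n%:~R = f n.
Proof.
rewrite coef_cseries_of; case: pselect => [e|[]]; last by exists n.
by have /intr_inj -> := projT2 (cid e).
Qed.

Lemma cseries_of_nonint f z : (forall n : int, n%:~R <> z) -> cseries_of f z = 0.
Proof.
by move=> nz; rewrite coef_cseries_of; case: pselect => // e; case: (nz _ (projT2 (cid e))).
Qed.

Lemma cseries_of_monomM (n : int) f :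
  cseries_of (monom 1 n * f) = monom 1 n%:~R * cseries_of f.
Proof.
apply: gseriesP => z; rewrite coef_monomM mul1r.
have [[m <-]|nz] := pselect (exists m : int, m%:~R = z).
  by rewrite -intrB !cseries_of_intr coef_monomM mul1r.
rewrite !cseries_of_nonint // => m mz; apply: nz.
  by exists (m + n); rewrite intrD mz subrK.
by exists m.
Qed.

Lemma cseries_of0 : cseries_of (0 : laurent R) = 0.
Proof.
by apply: gseriesP => z; rewrite coef_cseries_of; case: pselect.
Qed.

Lemma periodicz (f : R -> R) (T a : R) (n : int) :
  periodic f T -> f (a + T *~ n) = f a.
Proof.
move=> fT; case: n => n; first exact: periodicn.
by rewrite NegzE mulrNz -(periodicn fT n.+1) subrK.
Qed.

(** The source of independence of the branch: an integral change n of the exponent alters the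
    constant of the k-th branch by exp(2 pi i k n) = 1. *)
Lemma xi_powD (k n : int) z :
  xi_pow k (z + n%:~R) = monom 1 n%:~R * xi_pow k z.
Proof.
rewrite /xi_pow monomM mul1r [n%:~R + z]addrC; congr monom.
have -> : n%:~R = (n%:~R)%:C%C :> C by rewrite rmorph_int.
case: z => a b; rewrite /cexp /= !mulr0 !add0r.
have -> : (a + n%:~R) * (pi *+ 2 *~ k) = a * (pi *+ 2 *~ k) + pi *+ 2 *~ (k * n).
  by rewrite mulrDl mulrzl mulrzA.
by rewrite !addr0 (periodicz _ _ (@cosD2pi R)) (periodicz _ _ (@sinD2pi R)).
Qed.

Lemma map_loop_shift (g : {vspace MC}) mu s (k : int) u :
  is_diag_mx mu -> (g <= span s)%VS ->
  (forall x, x \in s -> exists n : int, lie mu x = n%:~R *: x) -> loop g u ->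
  map_mx (@cseries_of R) (loop_shift mu u) =
  tau k mu *m map_mx (@cseries_of R) u *m invmx (tau k mu).
Proof.
(* Moving the inverse to the other side leaves only products with diagonal matrices, which are
   compared entry by entry. *)
move=> muD gs ws gu; apply: (canRL (mulmxK (tau_unit k mu))).
apply/matrixP => i j; rewrite mul_mx_diag mul_diag_mx.
rewrite [LHS]mxE [RHS]mxE.
have mapE (v : ML) : map_mx (@cseries_of R) v i j = cseries_of (v i j) by rewrite mxE.
have rowE l : (\row_l xi_pow k (mu l l)) 0 l = xi_pow k (mu l l) by rewrite mxE.
rewrite !mapE !rowE loop_shiftE.
have [->|uij] := eqVneq (u i j) 0; first by rewrite mulr0 cseries_of0 mulr0 mul0r.
have [n mun] := loop_entry_integral muD gs ws gu uij.
(* With n = mu_i - mu_j, the factor xi^n turns xi^(mu_j) into xi^(mu_i), in the same branch. *)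
rewrite mun xi_intE cseries_of_monomM mulrAC -xi_powD -mun.
by rewrite [mu j j + _]addrC subrK.
Qed.

End Shift.

(** * Generators of [g] taken from a Chevalley basis *)

Section ChevalleyGenerators.
Variables (R : realType) (N : nat).
Local Notation C := R[i].
Local Notation MC := 'M[C]_N.
Variables (g h : {vspace MC}) (X : 'Hom(subvs_of h, C^o) -> MC).
Hypothesis hD : forall x, (x \in h) = (x \in g) && is_diag_mx x.
Hypothesis XC : chevalley g X.

Lemma chevalley_generators : exists s : seq MC, (g <= span s)%VS /\
  forall x, x \in s -> (exists2 a, is_root g a & x = X a) \/ x \in h.
Proof.
case: XC => _ XH _ [Delta [Pi [_ DeltaP [PiP _ _] /andP[/eqP gs _]]]].
exists ([seq X a | a <- Delta] ++ [seq lie (X a) (X (- a)) | a <- Pi]).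
split; first by rewrite gs.
move=> x; rewrite mem_cat => /orP[] /mapP[a]; last first.
  by move=> /PiP /XH [t th _] ->; right; rewrite -th; exact: subvsP.
by move=> /DeltaP aR ->; left; exists a.
Qed.

Lemma cartan_sub x : x \in h -> x \in g.
Proof. by rewrite hD => /andP[]. Qed.

Lemma cartan_diag x : x \in h -> is_diag_mx x.
Proof. by rewrite hD => /andP[]. Qed.

(** Orthogonality is applied to ad of the coroot r of a: it kills t, as diagonal matrices commute,
    and acts on [X a] by a(r) = 2, so the eigenvalues do not cancel. *)
Lemma form_cartan_root (c : C) (t : subvs_of h) a : lie_closed g -> is_root g a ->
  form g c (vsval t) (X a) = 0.
Proof.
case: XC => Xroot XH _ _ gL aR; have [Xg Xeigen] := Xroot _ aR.
have [r _ ar] := XH _ aR; have rh := subvsP r; have th := subvsP t.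
have rt : lie (vsval r) (vsval t) = 0 *: vsval t.
  by rewrite scale0r lie_diag_diag // cartan_diag.
have := form_eigen_orthogonal c gL (cartan_sub rh) (cartan_sub th) Xg rt (Xeigen r).
by rewrite ar add0r => /eqP; rewrite mulf_eq0 pnatr_eq0 => /eqP.
Qed.

End ChevalleyGenerators.

Theorem theorem1 (R : realType) (N : nat) (g h : {vspace 'M[R[i]]_N})
    (g_classical : classical g)
    (h_diag : forall x, (x \in h) = (x \in g) && is_diag_mx x)
    (h_cartan : cartan_subalgebra g h)
    (c : R[i]) (c_normalized : normalized g h c)
    (X : 'Hom(subvs_of h, (R[i])^o) -> 'M[R[i]]_N) (X_chevalley : chevalley g X)
    (mu : subvs_of h) (mu_coweight : coweight g mu) :
  exists phi : 'M[laurent R]_N -> 'M[laurent R]_N,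
    [/\ lie_automorphism (loop g) (@loop_scale R N) (@lie N (laurent R)) phi,
        (forall (k : int) (x : 'M[laurent R]_N), loop g x ->
           map_mx (@cseries_of R) (phi x) =
           tau k (vsval mu) *m map_mx (@cseries_of R) x *m
             invmx (tau k (vsval mu))),
        (exists sigma, single_shift g c X mu sigma)
      & (forall sigma, single_shift g c X mu sigma ->
           forall u, affine g u -> (sigma u).1 = phi u.1)].
Proof.
have [s [gs sP]] := chevalley_generators X_chevalley.
have gL := classical_lie_closed g_classical.
have muh := subvsP mu; have mug := cartan_sub h_diag muh.
have muD := cartan_diag h_diag muh.
have [Xroot _ _ _] := X_chevalley.
have sg : {subset s <= g}.
  by move=> x /sP[[a /Xroot[Xg _] -> //]|]; exact: (cartan_sub h_diag).
have weight_h x : x \in h -> lie (vsval mu) x = 0%:~R *: x.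
  by move=> xh; rewrite scale0r lie_diag_diag //; exact: (cartan_diag h_diag).
have weight_root a (n : int) : is_root g a -> a mu = n%:~R ->
    lie (vsval mu) (X a) = n%:~R *: X a.
  by move=> /Xroot[_ Xeigen] <-; exact: Xeigen.
have weight_s x : x \in s -> exists n : int, lie (vsval mu) x = n%:~R *: x.
  move=> /sP[[a aR ->]|xh]; last by exists 0; exact: weight_h.
  by have [n an] := mu_coweight _ aR; exists n; exact: weight_root.
have shift_h x f : x \in h -> loop_shift (vsval mu) (tens x f) = tens x f.
  by move=> xh; rewrite (loop_shift_tens _ muD (weight_h _ xh)) mul1r.
exists (loop_shift (vsval mu)); split.
- exact: loop_shift_automorphism muD gs sg weight_s.
- by move=> k x; exact: map_loop_shift muD gs weight_s.
- exists (affine_shift g c (vsval mu)); split.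
  + exact: affine_shift_automorphism gL mug muD gs sg weight_s.
  + by rewrite /affine_shift /= loop_shift0 twist0 addr0.
  + by move=> x f xh; rewrite /affine_shift /= shift_h // twist_tens add0r.
  + move=> a n f aR an; rewrite /affine_shift /= twist_tens.
    rewrite (form_cartan_root h_diag X_chevalley) // mul0r addr0.
    by rewrite (loop_shift_tens _ muD (weight_root _ _ aR an)).
(* An arbitrary single shift is determined modulo c by its values on root vectors and on the Cartan
   subalgebra, where it agrees with [loop_shift]. *)
move=> sigma [[_ sigmaD sigmaZ _] sigma_c sigma_h sigma_X] [u k] /= gu.
have sigma1D v w : loop g v -> loop g w ->
    (sigma (v + w, 0)).1 = (sigma (v, 0)).1 + (sigma (w, 0)).1.
  move=> gv gw; have -> : (v + w, 0) = (v, 0) + (w, 0) :> _ * R[i].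
    by congr pair; rewrite addr0.
  by rewrite sigmaD ?inE.
have sigma00 : (sigma (0, 0)).1 = 0.
  by apply: (addrI (sigma (0, 0)).1); rewrite -sigma1D ?addr0 //; exact: loop0.
(* The central part k c is fixed by [sigma] and vanishes in the quotient, so k = 0 may be
   assumed. *)
have -> : (u, k) = (u, 0) + affine_scale k (0, 1).
  by congr pair; rewrite /= ?mulr1 ?add0r // /loop_scale scaler0 addr0.
rewrite sigmaD ?inE //=; last exact/loop_loop_scale/loop0.
rewrite sigmaZ ?inE; last exact: loop0.
rewrite sigma_c /= /loop_scale scaler0 addr0.
(* Membership in the loop algebra is carried through the induction because [sigma] is known to be
   additive only there. *)
suff : loop g u /\ (sigma (u, 0)).1 = loop_shift (vsval mu) u by case.
move: u gu; apply: (loop_span_ind gs).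
- by split; [exact: loop0|rewrite loop_shift0].
- move=> v w [gv ev] [gw ew]; split; first exact: loopD.
  by rewrite sigma1D // loop_shiftD ev ew.
move=> x f xs; split; first exact/loop_tens/sg.
have [[a aR ->]|xh] := sP _ xs; last by rewrite sigma_h // shift_h.
have [n an] := mu_coweight _ aR.
by rewrite (sigma_X _ _ _ aR an) (loop_shift_tens _ muD (weight_root _ _ aR an)).
Qed.
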